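(* Let $E$ be an ellipse in 3-dimensional Euclidean space with eccentricity $0<e<1$, lying in a plane $\Pi$ and having major axis the segment $\overline{AP}$. Let $\Pi'$ be the plane through $\overline{AP}$ perpendicular to $\Pi$. Then for each $0<\theta<\pi$ there are exactly 4 cones of bloom $\theta$ belonging to $E$. Each of these cones is obtainable from the others by reflection in the plane $\Pi$ and in the plane through the center of the ellipse perpendicular to both $\Pi$ and $\Pi'$ (i.e. by applying one or both of these reflections). The vertices of all such cones lie on the hyperbola in $\Pi'$ having foci at $A$ and $P$ and eccentricity $\frac1e$.
   Context: A cone means a right circular (double) cone: given a line (the axis) and a point $V$ on it (the vertex), the cone is the locus of points $Q$ (together with $V$) such that the smaller positive angle between the line $QV$ and the axis has a fixed value in $(0,\pi/2)$. The lines $QV$ are the generators. The bloom of the cone is its full opening angle $\theta\in(0,\pi)$, i.e. the maximum plane angle between two generators, measured within one nappe; equivalently, $\theta$ is twice the angle between the axis and a generator. A cone $C$ is said to belong to the ellipse $E\subset\Pi$ if $E=C\cap\Pi$. The points $A$ and $P$ are the two endpoints of the major axis of $E$. *)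

(* Defs.v *)
From mathcomp Require Import all_boot all_order all_algebra.
From mathcomp Require Import all_classical all_reals all_analysis.

Set Implicit Arguments.
Unset Strict Implicit.
Unset Printing Implicit Defensive.

Import Order.TTheory GRing.Theory Num.Theory.

Local Open Scope classical_set_scope.
Local Open Scope ring_scope.

(* Euclidean 3-space is 'rV[R]_3 with the dot product below; the library norm
   on matrices is the sup norm, hence the separate [enorm]. *)

Definition dot (R : realType) (u v : 'rV[R]_3) : R := (u *m v^T) 0 0.

Definition enorm (R : realType) (u : 'rV[R]_3) : R := Num.sqrt (dot u u).

Definition edist (R : realType) (X Y : 'rV[R]_3) : R := enorm (X - Y).

Definition angle (R : realType) (u v : 'rV[R]_3) : R :=
  acos (dot u v / (enorm u * enorm v)).

(* Two lines directed by u and v form the two supplementary angles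
   [angle u v] and [pi - angle u v]. *)
Definition line_angle (R : realType) (u v : 'rV[R]_3) : R :=
  Num.min (angle u v) (pi - angle u v).

Definition line_through (R : realType) (X Y : 'rV[R]_3) : set 'rV[R]_3 :=
  [set Z | exists t : R, Z = X + t *: (Y - X)].

Record plane (R : realType) := Plane {
  plane_pt : 'rV[R]_3;
  plane_normal : 'rV[R]_3;
  plane_normal_neq0 : plane_normal != 0
}.

Definition plane_set (R : realType) (Pi : plane R) : set 'rV[R]_3 :=
  [set X | dot (plane_normal Pi) (X - plane_pt Pi) = 0].

Definition perpendicular (R : realType) (Pi Pi' : plane R) : Prop :=
  dot (plane_normal Pi) (plane_normal Pi') = 0.

Definition reflection (R : realType) (Pi : plane R) (X : 'rV[R]_3) :
    'rV[R]_3 :=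
  let n := plane_normal Pi in
  X - (2 * dot n (X - plane_pt Pi) / dot n n) *: n.

(* [ell_a] is the semi-major axis; coinciding foci (a circle) are allowed. *)
Record ellipse (R : realType) := Ellipse {
  ell_plane : plane R;
  ell_f1 : 'rV[R]_3;
  ell_f2 : 'rV[R]_3;
  ell_a : R;
  ell_f1_in : plane_set ell_plane ell_f1;
  ell_f2_in : plane_set ell_plane ell_f2;
  ell_lt : edist ell_f1 ell_f2 < 2 * ell_a
}.

Definition ell_set (R : realType) (E : ellipse R) : set 'rV[R]_3 :=
  [set X | plane_set (ell_plane E) X /\
           edist X (ell_f1 E) + edist X (ell_f2 E) = 2 * ell_a E].

Definition ell_ecc (R : realType) (E : ellipse R) : R :=
  edist (ell_f1 E) (ell_f2 E) / (2 * ell_a E).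

Definition ell_center (R : realType) (E : ellipse R) : 'rV[R]_3 :=
  2^-1 *: (ell_f1 E + ell_f2 E).

(* Meaningful only for distinct foci. *)
Definition major_axis_endpoints (R : realType) (E : ellipse R)
    (A P : 'rV[R]_3) : Prop :=
  ell_set E `&` line_through (ell_f1 E) (ell_f2 E) = [set A; P].

(* [hyp_a] is half the distance between the two vertices. *)
Record hyperbola (R : realType) := Hyperbola {
  hyp_plane : plane R;
  hyp_f1 : 'rV[R]_3;
  hyp_f2 : 'rV[R]_3;
  hyp_a : R;
  hyp_f1_in : plane_set hyp_plane hyp_f1;
  hyp_f2_in : plane_set hyp_plane hyp_f2;
  hyp_a_gt0 : 0 < hyp_a;
  hyp_lt : 2 * hyp_a < edist hyp_f1 hyp_f2
}.

Definition hyp_set (R : realType) (H : hyperbola R) : set 'rV[R]_3 :=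
  [set X | plane_set (hyp_plane H) X /\
           `|edist X (hyp_f1 H) - edist X (hyp_f2 H)| = 2 * hyp_a H].

Definition hyp_ecc (R : realType) (H : hyperbola R) : R :=
  edist (hyp_f1 H) (hyp_f2 H) / (2 * hyp_a H).

(* Presentation of a cone; two presentations (e.g. with opposite [cone_dir])
   may have the same [cone_set], so cones are counted as point sets. *)
Record cone (R : realType) := Cone {
  cone_vertex : 'rV[R]_3;
  cone_dir : 'rV[R]_3;
  cone_angle : R;
  cone_dir_neq0 : cone_dir != 0;
  cone_angle_bounds : 0 < cone_angle < pi / 2
}.

Definition cone_set (R : realType) (K : cone R) : set 'rV[R]_3 :=
  [set Q | Q = cone_vertex K \/
           (Q != cone_vertex K /\
            line_angle (Q - cone_vertex K) (cone_dir K) = cone_angle K)].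

Definition same_nappe (R : realType) (K : cone R) (Q Q' : 'rV[R]_3) : Prop :=
  [/\ cone_set K Q, cone_set K Q' &
      0 < dot (Q - cone_vertex K) (cone_dir K) *
          dot (Q' - cone_vertex K) (cone_dir K)].

Definition generator_angles (R : realType) (K : cone R) : set R :=
  [set phi | exists Q Q', same_nappe K Q Q' /\
     phi = angle (Q - cone_vertex K) (Q' - cone_vertex K)].

Definition has_bloom (R : realType) (K : cone R) (theta : R) : Prop :=
  generator_angles K theta /\ ubound (generator_angles K) theta.

Definition belongs_to (R : realType) (K : cone R) (E : ellipse R) : Prop :=
  ell_set E = cone_set K `&` plane_set (ell_plane E).

Definition cones_of_bloom (R : realType) (E : ellipse R) (theta : R) :
    set (set 'rV[R]_3) :=
  [set C | exists K : cone R,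
     [/\ C = cone_set K, has_bloom K theta & belongs_to K E]].

(* Main.v *)
(** In coordinates centred at the ellipse, with first axis along AP and third
    axis normal to the plane, a cone with vertex V, unit axis (l, m, n) and
    k = cos^2 (theta / 2) is ((l, m, n) . (Q - V))^2 = k |Q - V|^2.  Its trace on
    the plane is a conic equal to the ellipse only if its six coefficients are
    proportional to those of the ellipse (five points suffice).  This forces
    m = 0, l^2 = k e^2, puts the vertex at (p, 0, r), determines p^2 and r^2, and
    fixes the axis up to sign in terms of (p, r).  The four sign choices for
    (p, r) are exchanged by the two reflections; they give four different point
    sets because a cone determines its vertex. *)

Require Import Defs.
From mathcomp Require Import all_boot all_order all_algebra.
From mathcomp Require Import all_classical all_reals all_analysis.
From mathcomp Require Import ring lra.

Import Order.TTheory GRing.Theory Num.Theory.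

Local Open Scope classical_set_scope.
Local Open Scope ring_scope.

(** * Algebra of the dot product and perpendicular vectors *)

Lemma dotE {R : realType} (u v : 'rV[R]_3) :
  dot u v = u 0 0 * v 0 0 + u 0 1 * v 0 1 + u 0 2 * v 0 2.
Proof.
rewrite /dot !mxE !big_ord_recl big_ord0 !mxE addr0 addrA.
have -> : lift ord0 ord0 = 1 :> 'I_3 by exact/val_inj.
by have -> : lift ord0 (lift ord0 ord0) = 2 :> 'I_3 by exact/val_inj.
Qed.

Lemma dotC {R : realType} (u v : 'rV[R]_3) : dot u v = dot v u.
Proof. by rewrite !dotE; ring. Qed.

Lemma dot0l {R : realType} (u : 'rV[R]_3) : dot 0 u = 0.
Proof. by rewrite dotE !mxE; ring. Qed.

Lemma dotDl {R : realType} (u v w : 'rV[R]_3) :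
  dot (u + v) w = dot u w + dot v w.
Proof. by rewrite !dotE !mxE; ring. Qed.

Lemma dotDr {R : realType} (u v w : 'rV[R]_3) :
  dot w (u + v) = dot w u + dot w v.
Proof. by rewrite !dotE !mxE; ring. Qed.

Lemma dotZl {R : realType} (t : R) (u v : 'rV[R]_3) :
  dot (t *: u) v = t * dot u v.
Proof. by rewrite !dotE !mxE; ring. Qed.

Lemma dotZr {R : realType} (t : R) (u v : 'rV[R]_3) :
  dot u (t *: v) = t * dot u v.
Proof. by rewrite !dotE !mxE; ring. Qed.

Lemma dotNl {R : realType} (u v : 'rV[R]_3) : dot (- u) v = - dot u v.
Proof. by rewrite !dotE !mxE; ring. Qed.

Lemma dotNr {R : realType} (u v : 'rV[R]_3) : dot u (- v) = - dot u v.
Proof. by rewrite !dotE !mxE; ring. Qed.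

Lemma dotBl {R : realType} (u v w : 'rV[R]_3) :
  dot (u - v) w = dot u w - dot v w.
Proof. by rewrite dotDl dotNl. Qed.

Lemma dotBr {R : realType} (u v w : 'rV[R]_3) :
  dot w (u - v) = dot w u - dot w v.
Proof. by rewrite dotDr dotNr. Qed.

Definition dot_lin := (@dotDl, @dotDr, @dotBl, @dotBr, @dotNl, @dotNr,
  @dotZl, @dotZr).

Lemma dot_ge0 {R : realType} (u : 'rV[R]_3) : 0 <= dot u u.
Proof. by rewrite dotE -!expr2 !addr_ge0 ?sqr_ge0. Qed.

Lemma dot_eq0 {R : realType} (u : 'rV[R]_3) : (dot u u == 0) = (u == 0).
Proof.
apply/eqP/eqP => [|->]; last by rewrite dotE !mxE; ring.
rewrite dotE => h; apply/rowP => i; rewrite mxE.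
case: i => -[|[|[|//]]] hi.
- have -> : Ordinal hi = 0 by exact/val_inj.
  nra.
- have -> : Ordinal hi = 1 by exact/val_inj.
  nra.
- have -> : Ordinal hi = 2 by exact/val_inj.
  nra.
Qed.

Lemma dot_gt0 {R : realType} (u : 'rV[R]_3) : u != 0 -> 0 < dot u u.
Proof. by rewrite lt0r dot_eq0 dot_ge0 andbT. Qed.

Lemma dot_CS {R : realType} (u v : 'rV[R]_3) :
  dot u v ^+ 2 <= dot u u * dot v v.
Proof.
rewrite -subr_ge0 !dotE.
set a := u 0 0; set b := u 0 1; set c := u 0 2.
set x := v 0 0; set y := v 0 1; set z := v 0 2.
have -> : (a * a + b * b + c * c) * (x * x + y * y + z * z) -
    (a * x + b * y + c * z) ^+ 2 =
    (a * y - b * x) ^+ 2 + (a * z - c * x) ^+ 2 + (b * z - c * y) ^+ 2 by ring.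
by rewrite !addr_ge0 ?sqr_ge0.
Qed.

Lemma enorm_sqr {R : realType} (u : 'rV[R]_3) : enorm u ^+ 2 = dot u u.
Proof. by rewrite sqr_sqrtr ?dot_ge0. Qed.

Lemma enorm_gt0 {R : realType} (u : 'rV[R]_3) : u != 0 -> 0 < enorm u.
Proof. by move=> u0; rewrite sqrtr_gt0 dot_gt0. Qed.

Lemma enorm_unit {R : realType} (u : 'rV[R]_3) : u != 0 ->
  dot ((enorm u)^-1 *: u) ((enorm u)^-1 *: u) = 1.
Proof.
move=> u0; have h := enorm_gt0 _ u0.
by rewrite !dot_lin -enorm_sqr; field; rewrite gt_eqF.
Qed.

Lemma perp_vector {R : realType} (d : 'rV[R]_3) :
  exists n : 'rV[R]_3, n != 0 /\ dot n d = 0.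
Proof.
have [d0|d0] := eqVneq (d 0 0 ^+ 2 + d 0 1 ^+ 2) 0.
  exists (delta_mx 0 0); split.
    by apply/negP => /eqP/matrixP/(_ 0 0); rewrite !mxE /=; lra.
  by rewrite dotE !mxE /=; nra.
exists (\row_i [tuple - d 0 1; d 0 0; 0]`_i); split.
  apply/negP => /eqP h; move/negP: d0; apply; apply/eqP.
  move/matrixP: (h) => /(_ 0 0); move/matrixP: h => /(_ 0 1).
  by rewrite !mxE /= => -> /eqP; rewrite oppr_eq0 => /eqP ->; ring.
by rewrite dotE !mxE /=; ring.
Qed.

Lemma perp_vector_same_norm {R : realType} (d : 'rV[R]_3) :
  exists n : 'rV[R]_3, dot n d = 0 /\ dot n n = dot d d.
Proof.
have [n [n0 nd]] := perp_vector d.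
exists (enorm d *: ((enorm n)^-1 *: n)); split.
  by rewrite !dotZl nd !mulr0.
by rewrite dotZl dotZr enorm_unit // mulr1 -expr2 enorm_sqr.
Qed.

(** * Cones as quadrics: equation, bloom and vertex *)

Lemma cos_quotient_bounds {R : realType} (u v : 'rV[R]_3) :
  -1 <= dot u v / (enorm u * enorm v) <= 1.
Proof.
have [->|u0] := eqVneq u 0.
  by rewrite dotE !mxE !mul0r !addr0 mul0r; lra.
have [->|v0] := eqVneq v 0.
  by rewrite dotE !mxE !mulr0 !addr0 mul0r; lra.
have e0 : 0 < enorm u * enorm v by rewrite mulr_gt0 ?enorm_gt0.
rewrite -ler_norml normrM normfV (gtr0_norm e0) ler_pdivrMr // mul1r.
rewrite -(@ler_pXn2r _ 2) ?nnegrE ?(ltW e0) ?normr_ge0 //.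
by rewrite real_normK ?num_real // exprMn !enorm_sqr dot_CS.
Qed.

Lemma cos_cone_angle_gt0 {R : realType} (K : cone R) : 0 < cos (cone_angle K).
Proof.
have /andP[a0 a1] := cone_angle_bounds K.
by apply: cos_gt0_pihalf; rewrite a1 andbT; lra.
Qed.

Lemma sin_cone_angle_gt0 {R : realType} (K : cone R) : 0 < sin (cone_angle K).
Proof. exact/sin_gt0_pihalf/cone_angle_bounds. Qed.

(** Squaring the cosine identifies the two supplementary angles between lines, and since the cone
    angle is below [pi / 2], the smaller of them is the one selected. At the vertex both sides
    vanish, so the exceptional point needs no separate clause. *)
Lemma cone_setE {R : realType} (K : cone R) (Q : 'rV[R]_3) :
  let u := Q - cone_vertex K in
  cone_set K Q <-> dot u (cone_dir K) ^+ 2 =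
    cos (cone_angle K) ^+ 2 * dot (cone_dir K) (cone_dir K) * dot u u.
Proof.
move=> u; rewrite /cone_set /= -/u; set d := cone_dir K.
have /andP[a0 a1] := cone_angle_bounds K.
have c0 := cos_cone_angle_gt0 K; move: a0 a1 c0.
set al := cone_angle K => a0 a1 c0.
have [QV|QV] := eqVneq Q (cone_vertex K).
  have -> : u = 0 by rewrite /u QV subrr.
  by split=> // _; [rewrite !dotE !mxE; ring|left].
have u0 : u != 0 by rewrite subr_eq0.
have ud0 : 0 < enorm u * enorm d by rewrite mulr_gt0 ?enorm_gt0 ?cone_dir_neq0.
have cB := cos_quotient_bounds u d.
have -> : (dot u d ^+ 2 = cos al ^+ 2 * dot d d * dot u u) <->
    (dot u d / (enorm u * enorm d)) ^+ 2 = cos al ^+ 2.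
  rewrite -!enorm_sqr; split => h.
    by rewrite exprMn exprVn h; field; rewrite !gt_eqF ?enorm_gt0 ?cone_dir_neq0.
  have -> : dot u d = dot u d / (enorm u * enorm d) * (enorm u * enorm d).
    by rewrite divfK ?gt_eqF.
  by rewrite exprMn h; ring.
rewrite /line_angle /angle; set x := dot u d / _ in cB *.
have alB : al \in `[0, pi] by rewrite in_itv /=; apply/andP; split; lra.
split.
  case=> [h|[_]]; first by rewrite h eqxx in QV.
  rewrite minEle; case: ifP => _ h.
    by rewrite -h acosK // in_itv.
  by rewrite -h addrC cosDpi cosN acosK ?in_itv //= sqrrN.
move=> /eqP; rewrite eqf_sqr => /orP[]/eqP ->; right; split=> //.
  by rewrite cosK // min_l //; lra.
have -> : - cos al = cos (pi - al) by rewrite addrC cosDpi cosN.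
rewrite cosK ?min_r //; first by rewrite opprB addrC subrK.
  by lra.
by rewrite in_itv /=; apply/andP; split; lra.
Qed.

(** Two generators on one nappe have a bisector, and Cauchy-Schwarz for the bisector against the
    axis bounds their angle by [2 * al]. The bound is attained by two generators placed
    symmetrically about the axis in a plane containing it. *)
Lemma has_bloomE {R : realType} (K : cone R) (theta : R) :
  has_bloom K theta <-> theta = 2 * cone_angle K.
Proof.
set V := cone_vertex K; set d := cone_dir K; set al := cone_angle K.
have d0 : d != 0 := cone_dir_neq0 K; have dd := dot_gt0 _ d0.
have c0 : 0 < cos al := cos_cone_angle_gt0 K.
have /andP[a0 a1] : 0 < al < pi / 2 := cone_angle_bounds K.
have aB : 2 * al \in `[0, pi] by rewrite in_itv /=; apply/andP; split; lra.
have cos2 : cos (2 * al) = 2 * cos al ^+ 2 - 1.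
  have -> : 2 * al = al + al by ring.
  by rewrite cosD -!expr2 sin2cos2; ring.
have ub : ubound (generator_angles K) (2 * al).
  move=> phi [Q [Q' [[/cone_setE + /cone_setE]]]].
  rewrite -/V -/d -/al; move: (Q - V) (Q' - V) => u u'.
  move=> hu hu' pp ->.
  have u0 : u != 0.
    by apply/eqP => u0; move: pp; rewrite u0 dot0l mul0r ltxx.
  have u'0 : u' != 0.
    apply/eqP => u0'; move: pp.
    by rewrite u0' dot0l mulr0 ltxx.
  have g0 := enorm_gt0 _ u0; have g'0 := enorm_gt0 _ u'0.
  (* The cone equations give this identity only for the squares; being on the same nappe makes the
     left side positive and fixes the sign. *)
  have pp' : dot u d * dot u' d = cos al ^+ 2 * dot d d * (enorm u * enorm u').
    apply/eqP; rewrite -(@eqrXn2 _ 2) ?ltW //; last by rewrite !mulr_gt0 ?exprn_gt0.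
    by rewrite exprMn hu hu' -!enorm_sqr; apply/eqP; ring.
  (* Weighting each vector by the length of the other gives the direction of the angle bisector. *)
  have := dot_CS (enorm u' *: u + enorm u *: u') d.
  rewrite !dot_lin [dot u' u]dotC -!enorm_sqr => cs.
  rewrite /angle leNgt; apply/negP; rewrite -ltr_cos //; last first.
    by rewrite in_itv /= acos_ge0 ?acos_lepi ?cos_quotient_bounds.
  rewrite acosK ?in_itv /= ?cos_quotient_bounds // cos2.
  apply/negP; rewrite -leNgt ler_pdivlMr ?mulr_gt0 //.
  have {cs} : 4 * cos al ^+ 2 * (enorm u * enorm u') ^+ 2 * dot d d <=
     (2 * (enorm u * enorm u') ^+ 2 + 2 * (enorm u * enorm u') * dot u u')
     * dot d d.
    apply: le_trans (_ : (enorm u' * dot u d + enorm u * dot u' d) ^+ 2 <= _).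
      have -> : (enorm u' * dot u d + enorm u * dot u' d) ^+ 2 =
        enorm u' ^+ 2 * dot u d ^+ 2 + enorm u ^+ 2 * dot u' d ^+ 2
        + 2 * (enorm u * enorm u') * (dot u d * dot u' d) by ring.
      by rewrite hu hu' pp' -!enorm_sqr le_eqVlt; apply/orP; left; apply/eqP; ring.
    apply: le_trans cs _.
    by rewrite -!enorm_sqr le_eqVlt; apply/orP; left; apply/eqP; ring.
  rewrite ler_pM2r //.
  have := mulr_gt0 g0 g'0; set g := enorm u * enorm u' => gg h.
  rewrite -(ler_pM2l gg); lra.
have mem : generator_angles K (2 * al).
  have [n [nd nn]] := perp_vector_same_norm d.
  have dn : dot d n = 0 by rewrite dotC.
  have cs : cos al ^+ 2 + sin al ^+ 2 = 1 := cos2Dsin2 al.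
  have E1 (s : R) : s ^+ 2 = sin al ^+ 2 ->
      dot (cos al *: d + s *: n) (cos al *: d + s *: n) = dot d d.
    move=> hs; rewrite !dot_lin nd dn nn !mulr0 addr0 add0r !mulrA -!expr2 hs.
    by rewrite -mulrDl cs mul1r.
  have E2 (s : R) : dot (cos al *: d + s *: n) d = cos al * dot d d.
    by rewrite !dot_lin nd mulr0 addr0.
  exists (V + (cos al *: d + sin al *: n)), (V + (cos al *: d + (- sin al) *: n)).
  have E3 (X : 'rV[R]_3) : V + X - V = X by rewrite addrC addKr.
  split.
    split; rewrite -/V -/d ?E3 ?E2; last by rewrite !mulr_gt0.
      by apply/cone_setE; rewrite -/V -/d -/al E3 E1 // E2; ring.
    by apply/cone_setE; rewrite -/V -/d -/al E3 E1 ?sqrrN // E2; ring.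
  rewrite -/V !E3.
  have e0 : 0 < enorm d := enorm_gt0 _ d0.
  rewrite /angle /enorm !E1 ?sqrrN // -/(enorm d) -expr2 enorm_sqr.
  rewrite !dot_lin nd dn nn !mulr0 addr0 add0r.
  have -> : (cos al * (cos al * dot d d) + sin al * (- sin al * dot d d)) /
      dot d d = cos (2 * al).
    rewrite cos2; have -> : 2 * cos al ^+ 2 - 1 = cos al ^+ 2 - sin al ^+ 2.
      by lra.
    by field; rewrite gt_eqF.
  by rewrite cosK.
split=> [[h1 h2]|->//].
by apply/eqP; rewrite eq_le (ub _ h1) (h2 _ mem).
Qed.

(** Supplies whole generators of the cone as parametrised lines through the vertex. Only the square
    of [s] is prescribed, so both sides of the axis are covered. *)
Lemma cone_set_generator {R : realType} (K : cone R) (n : 'rV[R]_3) (t s : R) :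
  let d := cone_dir K in
  dot n d = 0 -> dot n n = dot d d -> s ^+ 2 = sin (cone_angle K) ^+ 2 ->
  cone_set K (cone_vertex K + t *: (cos (cone_angle K) *: d + s *: n)).
Proof.
move=> d nd nn hs; apply/cone_setE; rewrite -/d addrAC subrr add0r.
have dn : dot d n = 0 by rewrite dotC.
rewrite !dot_lin nd dn nn !mulr0 addr0 add0r.
have cs := cos2Dsin2 (cone_angle K).
transitivity ((t * cos (cone_angle K) * dot d d) ^+ 2 * 1); first by ring.
by rewrite -[in LHS]cs -hs; ring.
Qed.

(* If the sets agree, every generator of [K] through its vertex lies on the
   quadric of [K'], so the polar of [cone_vertex K - cone_vertex K'] with
   respect to that (nondegenerate) quadric vanishes. *)
Lemma cone_vertex_eq {R : realType} (K K' : cone R) :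
  cone_set K = cone_set K' -> cone_vertex K = cone_vertex K'.
Proof.
move=> KK'; set d := cone_dir K; set d' := cone_dir K'.
set c' := cos (cone_angle K') ^+ 2.
have [w wE] : exists w, w = cone_vertex K - cone_vertex K' by eexists.
set z := dot w d' *: d' - (c' * dot d' d') *: w.
have c0 := cos_cone_angle_gt0 K; have s0 := sin_cone_angle_gt0 K.
have polar (n : 'rV[R]_3) (s : R) : dot n d = 0 -> dot n n = dot d d ->
    s ^+ 2 = sin (cone_angle K) ^+ 2 ->
    dot z (cos (cone_angle K) *: d + s *: n) = 0.
  move=> nd nn hs; set u := (X in dot z X).
  have on t : dot (w + t *: u) d' ^+ 2 =
      c' * dot d' d' * dot (w + t *: u) (w + t *: u).
    have : cone_set K' (cone_vertex K + t *: u).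
      by rewrite -KK'; exact: cone_set_generator.
    by move=> /cone_setE; rewrite addrAC -wE.
  clearbody u.
  (* Subtracting the values at [t = 1] and [t = -1] kills the even terms and leaves the coefficient
     of [t], which is twice [dot z u]. *)
  have := on 1; have := on (-1); rewrite /z !dot_lin [dot u w]dotC [dot d' u]dotC.
  move: (dot w d') (dot u d') (dot w u) (dot w w) (dot u u) (dot d' d').
  by move=> *; lra.
have zn (n : 'rV[R]_3) : dot n d = 0 -> dot n n = dot d d ->
    dot z d = 0 /\ dot z n = 0.
  move=> nd nn; have := polar n _ nd nn erefl.
  have := polar n (- sin (cone_angle K)) nd nn (sqrrN _).
  rewrite !dot_lin => h1 h2; split; apply/eqP.
    rewrite -(mulrI_eq0 _ (lregP (lt0r_neq0 c0))); apply/eqP; lra.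
  rewrite -(mulrI_eq0 _ (lregP (lt0r_neq0 s0))); apply/eqP; lra.
have zd : dot z d = 0.
  by have [n [nd nn]] := perp_vector_same_norm d; have [] := zn n nd nn.
have z0 : z = 0.
  apply/eqP/negP => /negP z0; have ez := enorm_gt0 _ z0.
  have ed : 0 < enorm d := enorm_gt0 _ (cone_dir_neq0 K).
  (* Since [z] is orthogonal to [d], its multiple of length [enorm d] is itself an admissible [n],
     which makes [z] orthogonal to itself. *)
  have [] := zn (enorm d *: ((enorm z)^-1 *: z)).
  - by rewrite !dotZl zd !mulr0.
  - by rewrite dotZl dotZr enorm_unit // mulr1 -expr2 enorm_sqr.
  move=> _ /eqP; rewrite !dotZr !mulf_eq0 invr_eq0 dot_eq0.
  by rewrite !gt_eqF // (negbTE z0).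
have d'0 : 0 < dot d' d' := dot_gt0 _ (cone_dir_neq0 K').
have c'1 : 1 - c' = sin (cone_angle K') ^+ 2 by rewrite sin2cos2.
have s'0 : 0 < 1 - c' by rewrite c'1 exprn_gt0 ?sin_cone_angle_gt0.
(* Pairing [z] with [d'] isolates [dot w d']. Once that vanishes, [z] is a nonzero multiple of [w],
   so [w = 0]. *)
have wd' : dot w d' = 0.
  have : dot z d' = (1 - c') * dot d' d' * dot w d' by rewrite /z !dot_lin; ring.
  by rewrite z0 dot0l => /esym/eqP; rewrite !mulf_eq0 (gt_eqF s'0) (gt_eqF d'0) => /eqP.
have /eqP : z = 0 by [].
rewrite /z wd' scale0r sub0r oppr_eq0 scaler_eq0 mulf_eq0.
rewrite (gt_eqF d'0) gt_eqF ?exprn_gt0 ?cos_cone_angle_gt0 //=.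
by rewrite wE subr_eq0 => /eqP.
Qed.

(** * Orthonormal frames, coordinates and reflections *)

Record frame (R : realType) := Frame {
  fO : 'rV[R]_3;
  fi : 'rV[R]_3;
  fj : 'rV[R]_3;
  fk : 'rV[R]_3;
  fii : dot fi fi = 1;
  fjj : dot fj fj = 1;
  fkk : dot fk fk = 1;
  fij : dot fi fj = 0;
  fik : dot fi fk = 0;
  fjk : dot fj fk = 0
}.
Arguments fO {R}. Arguments fi {R}. Arguments fj {R}. Arguments fk {R}.

Definition lin3 {R : realType} (F : frame R) (x y z : R) : 'rV[R]_3 :=
  x *: fi F + y *: fj F + z *: fk F.

Definition pt {R : realType} (F : frame R) (x y z : R) : 'rV[R]_3 :=
  fO F + lin3 F x y z.

Lemma dot_lin3 {R : realType} (F : frame R) (x y z x' y' z' : R) :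
  dot (lin3 F x y z) (lin3 F x' y' z') = x * x' + y * y' + z * z'.
Proof.
rewrite /lin3 !dot_lin (dotC (fj F) (fi F)) (dotC (fk F) (fi F)).
rewrite (dotC (fk F) (fj F)) !(fii, fjj, fkk, fij, fik, fjk); ring.
Qed.

Lemma lin3_dot {R : realType} (F : frame R) (u : 'rV[R]_3) :
  u = lin3 F (dot u (fi F)) (dot u (fj F)) (dot u (fk F)).
Proof.
pose M : 'M[R]_3 := \matrix_i [tuple fi F; fj F; fk F]`_i.
have rM (i : 'I_3) (j : 'I_3) : (M *m M^T) i j =
    dot [tuple fi F; fj F; fk F]`_i [tuple fi F; fj F; fk F]`_j.
  by rewrite /dot !mxE; apply: eq_bigr => k _; rewrite !mxE.
(* The rows of [M] are orthonormal; for a square matrix this also gives [M^T *m M = 1], which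
   expands every vector in the frame. *)
have MM : M *m M^T = 1%:M.
  apply/matrixP => i j; rewrite rM mxE.
  case: i => -[|[|[|//]]] hi; case: j => -[|[|[|//]]] hj;
  by rewrite /= ?(fii, fjj, fkk, fij, fik, fjk) // dotC ?(fij, fik, fjk).
have {1}-> : u = u *m M^T *m M by rewrite -mulmxA (mulmx1C MM) mulmx1.
apply/rowP => j; rewrite /lin3 !mxE !big_ord_recl big_ord0 !mxE /= addr0 addrA.
by rewrite /dot !mxE; congr (_ + _ + _); congr (_ * _); apply: eq_bigr => k _;
  rewrite !mxE.
Qed.

Lemma lin3_inj {R : realType} (F : frame R) (x y z x' y' z' : R) :
  lin3 F x y z = lin3 F x' y' z' -> [/\ x = x', y = y' & z = z'].
Proof.
move=> h; have H (a b c : R) := congr1 (dot (lin3 F a b c)) h.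
by move: (H 1 0 0) (H 0 1 0) (H 0 0 1); rewrite !dot_lin3; split; lra.
Qed.

Lemma lin3D {R : realType} (F : frame R) (x y z x' y' z' : R) :
  lin3 F x y z + lin3 F x' y' z' = lin3 F (x + x') (y + y') (z + z').
Proof. by rewrite /lin3 !scalerDl [LHS]addrACA [X in X + _ = _]addrACA. Qed.

Lemma lin3Z {R : realType} (F : frame R) (t x y z : R) :
  t *: lin3 F x y z = lin3 F (t * x) (t * y) (t * z).
Proof. by rewrite /lin3 !scalerDr !scalerA. Qed.

Lemma lin3N {R : realType} (F : frame R) (x y z : R) :
  - lin3 F x y z = lin3 F (- x) (- y) (- z).
Proof. by rewrite -scaleN1r lin3Z !mulN1r. Qed.

Lemma lin3B {R : realType} (F : frame R) (x y z x' y' z' : R) :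
  lin3 F x y z - lin3 F x' y' z' = lin3 F (x - x') (y - y') (z - z').
Proof. by rewrite lin3N lin3D. Qed.

Lemma pt_surj {R : realType} (F : frame R) (X : 'rV[R]_3) :
  exists x y z, X = pt F x y z.
Proof.
exists (dot (X - fO F) (fi F)), (dot (X - fO F) (fj F)), (dot (X - fO F) (fk F)).
by rewrite /pt -lin3_dot addrC subrK.
Qed.

Lemma ptB {R : realType} (F : frame R) (x y z x' y' z' : R) :
  pt F x y z - pt F x' y' z' = lin3 F (x - x') (y - y') (z - z').
Proof. by rewrite -lin3B /pt opprD addrACA subrr add0r. Qed.

Lemma pt_inj {R : realType} (F : frame R) (x y z x' y' z' : R) :
  pt F x y z = pt F x' y' z' -> [/\ x = x', y = y' & z = z'].
Proof. by move=> /(@addrI _ (fO F))/(@lin3_inj _ F). Qed.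

Lemma edist_ptE {R : realType} (F : frame R) (x y z x' y' z' : R) :
  Defs.edist (pt F x y z) (pt F x' y' z') =
  Num.sqrt ((x - x') ^+ 2 + (y - y') ^+ 2 + (z - z') ^+ 2).
Proof. by rewrite /Defs.edist ptB /enorm dot_lin3 -!expr2. Qed.

Lemma plane_ptE {R : realType} (F : frame R) (Pi : plane R) (a b c x y z : R) :
  plane_normal Pi = lin3 F a b c -> plane_set Pi (fO F) ->
  dot (plane_normal Pi) (pt F x y z - plane_pt Pi) = a * x + b * y + c * z.
Proof.
move=> nE hO; rewrite /pt addrAC dotDr (_ : dot _ (fO F - _) = 0) // add0r.
by rewrite nE dot_lin3.
Qed.

Lemma reflection_ptE {R : realType} (F : frame R) (Pi : plane R)
    (a b c x y z : R) :
  plane_normal Pi = lin3 F a b c -> plane_set Pi (fO F) ->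
  let t := 2 * (a * x + b * y + c * z) / (a ^+ 2 + b ^+ 2 + c ^+ 2) in
  reflection Pi (pt F x y z) = pt F (x - t * a) (y - t * b) (z - t * c).
Proof.
move=> nE hO t; rewrite /reflection (plane_ptE _ _ _ _ _ _ _ _ nE hO).
by rewrite nE dot_lin3 -!expr2 -/t lin3Z /pt -addrA lin3B.
Qed.

Lemma reflection_i {R : realType} (F : frame R) (Pi : plane R) (a x y z : R) :
  plane_normal Pi = lin3 F a 0 0 -> plane_set Pi (fO F) ->
  reflection Pi (pt F x y z) = pt F (- x) y z.
Proof.
move=> nE hO; rewrite (reflection_ptE _ _ _ _ _ _ _ _ nE hO).
have a0 : a != 0.
  apply: contraNneq (plane_normal_neq0 Pi) => a0.
  by rewrite nE a0 /lin3 !scale0r !addr0.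
by congr (pt _ _ _ _); field; rewrite ?a0 //; nra.
Qed.

Lemma reflection_k {R : realType} (F : frame R) (Pi : plane R) (a x y z : R) :
  plane_normal Pi = lin3 F 0 0 a -> plane_set Pi (fO F) ->
  reflection Pi (pt F x y z) = pt F x y (- z).
Proof.
move=> nE hO; rewrite (reflection_ptE _ _ _ _ _ _ _ _ nE hO).
have a0 : a != 0.
  apply: contraNneq (plane_normal_neq0 Pi) => a0.
  by rewrite nE a0 /lin3 !scale0r !addr0.
by congr (pt _ _ _ _); field; rewrite ?a0 //; nra.
Qed.

(** * The ellipse in adapted coordinates *)

(** Both sides amount to the focal distances being [a + e * x] and [a - e * x]. In the converse
    direction the equation forces [x] between [- a] and [a], so these numbers are nonnegative and
    are determined by their squares. *)
Lemma sum_dist_ellipse {R : realType} (a e x y D1 D2 : R) :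
  0 < a -> 0 < e < 1 -> 0 <= D1 -> 0 <= D2 ->
  D1 ^+ 2 = (x + a * e) ^+ 2 + y ^+ 2 ->
  D2 ^+ 2 = (x - a * e) ^+ 2 + y ^+ 2 ->
  (D1 + D2 = 2 * a) <-> ((1 - e ^+ 2) * x ^+ 2 + y ^+ 2 = a ^+ 2 * (1 - e ^+ 2)).
Proof.
move=> a0 /andP[e0 e1] D10 D20 h1 h2; split=> h.
  have hd : D1 - D2 = 2 * e * x.
    apply: (mulfI (_ : 2 * a != 0)); first by rewrite mulf_neq0 ?gt_eqF.
    rewrite -[in LHS]h; transitivity (D1 ^+ 2 - D2 ^+ 2); first by ring.
    by rewrite h1 h2; ring.
  have D1E : D1 = a + e * x by lra.
  by move: h1; rewrite D1E; lra.
have ee : 0 < 1 - e ^+ 2 by nra.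
have xa : x ^+ 2 <= a ^+ 2 by rewrite -(ler_pM2l ee); have := sqr_ge0 y; lra.
have {}xa : `|x| <= a.
  by rewrite -(@ler_pXn2r _ 2) ?nnegrE ?(ltW a0) // real_normK ?num_real.
have ex : `|e * x| <= a.
  by rewrite normrM gtr0_norm //; have := normr_ge0 x; nra.
move: ex; rewrite ler_norml => /andP[ex1 ex2].
have -> : D1 = a + e * x.
  by apply/eqP; rewrite -(@eqrXn2 _ 2) //; [apply/eqP; rewrite h1; lra|lra].
have -> : D2 = a - e * x.
  by apply/eqP; rewrite -(@eqrXn2 _ 2) //; [apply/eqP; rewrite h2; lra|lra].
ring.
Qed.

Record adapted {R : realType} (F : frame R) (E : ellipse R) (a e : R) : Prop :=
  Adapted {
    ad_a : 0 < a;
    ad_e : 0 < e < 1;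
    ad_ell_a : ell_a E = a;
    ad_f1 : ell_f1 E = pt F (- (a * e)) 0 0;
    ad_f2 : ell_f2 E = pt F (a * e) 0 0;
    ad_O : plane_set (ell_plane E) (fO F);
    ad_normal : exists s, s != 0 /\ plane_normal (ell_plane E) = lin3 F 0 0 s
  }.

Lemma ell_plane_ptE {R : realType} (F : frame R) (E : ellipse R) (a e x y z : R) :
  adapted F E a e -> plane_set (ell_plane E) (pt F x y z) <-> z = 0.
Proof.
move=> [_ _ _ _ _ hO [s [s0 nE]]].
rewrite /plane_set /= (plane_ptE _ _ _ _ _ _ _ _ nE hO) !mul0r !add0r.
by split=> [/eqP|->]; [rewrite mulf_eq0 (negbTE s0) => /eqP|rewrite mulr0].
Qed.

Lemma ell_set_ptE {R : realType} (F : frame R) (E : ellipse R) (a e x y z : R) :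
  adapted F E a e ->
  ell_set E (pt F x y z) <->
    z = 0 /\ (1 - e ^+ 2) * x ^+ 2 + y ^+ 2 = a ^+ 2 * (1 - e ^+ 2).
Proof.
move=> ad; have pE := ell_plane_ptE _ _ _ _ x y z ad.
have [a0 e01 aE f1E f2E _ _] := ad.
have H : z = 0 -> Defs.edist (pt F x y z) (ell_f1 E) + Defs.edist (pt F x y z) (ell_f2 E)
    = 2 * ell_a E <-> (1 - e ^+ 2) * x ^+ 2 + y ^+ 2 = a ^+ 2 * (1 - e ^+ 2).
  move=> z0; rewrite aE f1E f2E !edist_ptE z0.
  apply: sum_dist_ellipse => //; rewrite ?sqrtr_ge0 // sqr_sqrtr;
    by [ring|rewrite !addr_ge0 ?sqr_ge0].
by split=> [[/pE z0 /(H z0)]|[z0 /(H z0)]]; split=> //; apply/pE.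
Qed.

(** * Cones whose plane section is the ellipse *)

(** Evaluating the trace equation at five points of the ellipse already fixes its coefficients up to
    a common factor; the axis being a unit vector then turns these relations into equations for the
    vertex. *)
Lemma conic_coefs {R : realType} (a e k p q r l m n : R) :
  0 < a -> 0 < e < 1 -> 0 < k < 1 -> l ^+ 2 + m ^+ 2 + n ^+ 2 = 1 ->
  (forall x y, (l * (x - p) + m * (y - q) + n * (0 - r)) ^+ 2 =
      k * ((x - p) ^+ 2 + (y - q) ^+ 2 + (0 - r) ^+ 2) <->
      (1 - e ^+ 2) * x ^+ 2 + y ^+ 2 = a ^+ 2 * (1 - e ^+ 2)) ->
  [/\ m = 0, q = 0, l ^+ 2 = k * e ^+ 2 & k * (1 - e ^+ 2) * p = l * n * r] /\
  (1 - k) * r ^+ 2 = k * (a * (1 - e ^+ 2)) ^+ 2 /\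
  (1 - k) * p ^+ 2 = (a * e) ^+ 2 * (1 - k * e ^+ 2).
Proof.
move=> a0 /andP[e0 e1] /andP[k0 k1] unit H.
have ee : 0 < 1 - e ^+ 2 by nra.
set s := l * p + m * q + n * r.
set G := s ^+ 2 - k * (p ^+ 2 + q ^+ 2 + r ^+ 2).
pose f x y := (l ^+ 2 - k) * x ^+ 2 + 2 * (l * m) * (x * y)
  + (m ^+ 2 - k) * y ^+ 2 - 2 * (l * s - k * p) * x - 2 * (m * s - k * q) * y + G.
have fE x y : f x y = 0 <-> (1 - e ^+ 2) * x ^+ 2 + y ^+ 2 = a ^+ 2 * (1 - e ^+ 2).
  rewrite -H; have -> : f x y =
    (l * (x - p) + m * (y - q) + n * (0 - r)) ^+ 2 -
    k * ((x - p) ^+ 2 + (y - q) ^+ 2 + (0 - r) ^+ 2) by rewrite /f /G /s; ring.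
  by split=> [/eqP|->]; [rewrite subr_eq0 => /eqP|rewrite subrr].
pose b := Num.sqrt (a ^+ 2 * (1 - e ^+ 2)).
have b0 : 0 < b by rewrite sqrtr_gt0 mulr_gt0 ?exprn_gt0.
have bb : b ^+ 2 = a ^+ 2 * (1 - e ^+ 2).
  by rewrite sqr_sqrtr // mulr_ge0 ?sqr_ge0 ?ltW.
have G0 : G != 0.
  apply/eqP => G0; have /fE : f 0 0 = 0 by rewrite /f G0; ring.
  by have := mulr_gt0 (exprn_gt0 2 a0) ee; lra.
have h1 : f a 0 = 0 by apply/fE; ring.
have h2 : f (- a) 0 = 0 by apply/fE; ring.
have h3 : f 0 b = 0 by apply/fE; rewrite bb; ring.
have h4 : f 0 (- b) = 0 by apply/fE; rewrite sqrrN bb; ring.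
(* The triple 3, 4, 5 gives a point of the ellipse off both axes, where the mixed term [l * m] is
   visible. *)
have h5 : f (3 / 5 * a) (4 / 5 * b) = 0.
  by apply/fE; rewrite exprMn [(4 / 5 * b) ^+ 2]exprMn bb; field.
have cancel (t u : R) : 0 < t -> t * u = 0 -> u = 0.
  by move=> t0 /eqP; rewrite mulf_eq0 gt_eqF // => /eqP.
(* Sums over opposite endpoints of an axis isolate the square coefficients, differences the linear
   ones. *)
have la : (l ^+ 2 - k) * a ^+ 2 = - G by move: h1 h2; rewrite /f; lra.
have mb : (m ^+ 2 - k) * b ^+ 2 = - G by move: h3 h4; rewrite /f; lra.
have ls : l * s = k * p.
  by apply/subr0_eq/(cancel _ _ a0); move: h1 h2; rewrite /f; lra.
have ms : m * s = k * q.
  by apply/subr0_eq/(cancel _ _ b0); move: h3 h4; rewrite /f; lra.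
have lm : l * m = 0.
  apply/(cancel _ _ a0)/(cancel _ _ b0).
  by move: h5; rewrite /f ls ms; lra.
(* If [l] vanished, [la] and [mb] would give [k * a ^+ 2 * e ^+ 2 + m ^+ 2 * a ^+ 2 * (1 - e ^+ 2) =
   0], a sum with a positive first term and a nonnegative second one. *)
have l0 : l != 0.
  apply/eqP => l0; move: la mb; rewrite l0 bb => la mb.
  have := mulr_gt0 (exprn_gt0 2 a0) k0.
  have := mulr_ge0 (sqr_ge0 m) (mulr_ge0 (sqr_ge0 a) (ltW ee)).
  have := mulr_gt0 (mulr_gt0 k0 (exprn_gt0 2 a0)) (exprn_gt0 2 e0).
  by lra.
have m0 : m = 0 by move/eqP: lm; rewrite mulf_eq0 (negbTE l0) => /eqP.
have q0 : q = 0 by apply/(cancel _ _ k0); rewrite -ms m0 mul0r.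
have GE : G = k * (a ^+ 2 * (1 - e ^+ 2)) by move: mb; rewrite m0 bb; lra.
have l2 : l ^+ 2 = k * e ^+ 2.
  by apply/subr0_eq/(cancel _ _ (exprn_gt0 2 a0)); move: la; rewrite GE; lra.
have sE : s = l * p + n * r by rewrite /s m0 q0; ring.
have n2 : n ^+ 2 = 1 - k * e ^+ 2 by move: unit; rewrite l2 m0; lra.
have lnr : k * (1 - e ^+ 2) * p = l * n * r.
  have : k * p = l ^+ 2 * p + l * n * r by rewrite -ls sE; ring.
  by rewrite l2; lra.
have sp : s ^+ 2 * e ^+ 2 = k * p ^+ 2.
  apply/subr0_eq/(cancel _ _ k0).
  transitivity ((l * s) ^+ 2 - (k * p) ^+ 2); first by rewrite exprMn l2; ring.
  by rewrite ls subrr.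
(* Comparing the two expressions for [G] eliminates [k]: this is the hyperbola [p^2 / (a e)^2 - r^2
   / (a^2 (1 - e^2)) = 1], on which the vertex lies for every opening. *)
have hyp : (1 - e ^+ 2) * p ^+ 2 = e ^+ 2 * (r ^+ 2 + a ^+ 2 * (1 - e ^+ 2)).
  apply/subr0_eq/(cancel _ _ k0).
  have : e ^+ 2 * G = k * p ^+ 2 - e ^+ 2 * k * (p ^+ 2 + r ^+ 2).
    by rewrite -sp /G q0; ring.
  by rewrite GE; lra.
(* Squaring [lnr] and eliminating [p] through [hyp] leaves an equation in [r] alone. *)
have rE : (1 - k) * r ^+ 2 = k * (a * (1 - e ^+ 2)) ^+ 2.
  apply/subr0_eq/(cancel _ _ (mulr_gt0 k0 (exprn_gt0 2 e0))).
  have : (l * n * r) ^+ 2 = k * e ^+ 2 * (1 - k * e ^+ 2) * r ^+ 2.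
    by rewrite !exprMn l2 n2.
  rewrite -lnr; have -> : (k * (1 - e ^+ 2) * p) ^+ 2 =
    k ^+ 2 * (1 - e ^+ 2) * ((1 - e ^+ 2) * p ^+ 2) by ring.
  by rewrite hyp; lra.
split=> //; split=> //.
apply/subr0_eq/(cancel _ _ ee).
transitivity ((1 - k) * ((1 - e ^+ 2) * p ^+ 2)
   - (1 - e ^+ 2) * ((a * e) ^+ 2 * (1 - k * e ^+ 2))); first by ring.
rewrite hyp; transitivity (e ^+ 2 * ((1 - k) * r ^+ 2) + (1 - k) * e ^+ 2 *
   (a ^+ 2 * (1 - e ^+ 2)) - (1 - e ^+ 2) * ((a * e) ^+ 2 * (1 - k * e ^+ 2))).
  by ring.
by rewrite rE; ring.
Qed.

(* The equation of the cone with vertex (p, 0, r), cos^2 of the half-opening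
   equal to k, and axis determined by [conic_coefs], multiplied by r. *)
Definition cone_poly {R : realType} (k e p r x y z : R) : R :=
  r * (k * e ^+ 2 * (x - p) ^+ 2 + (1 - k * e ^+ 2) * (z - r) ^+ 2
       - k * ((x - p) ^+ 2 + y ^+ 2 + (z - r) ^+ 2))
  + 2 * (k * (1 - e ^+ 2) * p) * (x - p) * (z - r).

(** The factor [r] allows the mixed coefficient [l * n * r] to be replaced by
    [k * (1 - e ^+ 2) * p], so the axis, known only up to sign, disappears from the equation. *)
Lemma cone_polyE {R : realType} (k e p r l n x y z : R) :
  r != 0 -> l ^+ 2 = k * e ^+ 2 -> n ^+ 2 = 1 - k * e ^+ 2 ->
  k * (1 - e ^+ 2) * p = l * n * r ->
  (l * (x - p) + n * (z - r)) ^+ 2 = k * ((x - p) ^+ 2 + y ^+ 2 + (z - r) ^+ 2)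
  <-> cone_poly k e p r x y z = 0.
Proof.
move=> r0 l2 n2 lnr.
have -> : cone_poly k e p r x y z = r * ((l * (x - p) + n * (z - r)) ^+ 2 -
    k * ((x - p) ^+ 2 + y ^+ 2 + (z - r) ^+ 2)).
  by rewrite /cone_poly lnr -n2 -l2; ring.
split=> [->|/eqP]; first by rewrite subrr mulr0.
by rewrite mulf_eq0 (negbTE r0) subr_eq0 => /eqP.
Qed.

(** At [z = 0] the terms linear in [x] cancel, and the vertex equations reduce the polynomial to the
    ellipse equation times [k * r]. *)
Lemma cone_poly_ellipse {R : realType} (a e k p r x y : R) :
  0 < k < 1 -> r != 0 ->
  (1 - k) * r ^+ 2 = k * (a * (1 - e ^+ 2)) ^+ 2 ->
  (1 - k) * p ^+ 2 = (a * e) ^+ 2 * (1 - k * e ^+ 2) ->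
  cone_poly k e p r x y 0 = 0 <->
  (1 - e ^+ 2) * x ^+ 2 + y ^+ 2 = a ^+ 2 * (1 - e ^+ 2).
Proof.
move=> /andP[k0 k1] r0 hr hp.
have {}k1 : 0 < 1 - k by rewrite subr_gt0.
have E : (1 - k) * cone_poly k e p r x y 0 = (1 - k) * (k * r *
    (a ^+ 2 * (1 - e ^+ 2) - ((1 - e ^+ 2) * x ^+ 2 + y ^+ 2))).
  transitivity (r * (k * (1 - e ^+ 2) * ((1 - k) * p ^+ 2)
     + (1 - k * e ^+ 2 - k) * ((1 - k) * r ^+ 2)
     - (1 - k) * k * ((1 - e ^+ 2) * x ^+ 2 + y ^+ 2))).
    by rewrite /cone_poly; ring.
  by rewrite hr hp; ring.
have {E} := mulfI (lt0r_neq0 k1) E => ->.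
split=> [/eqP|->]; last by rewrite subrr mulr0.
by rewrite !mulf_eq0 (negbTE r0) gt_eqF //= subr_eq0 => /eqP/esym.
Qed.

Lemma cone_ptE {R : realType} (F : frame R) (K : cone R) :
  exists p q r l m n, [/\ cone_vertex K = pt F p q r,
    l ^+ 2 + m ^+ 2 + n ^+ 2 = 1 &
    forall x y z, cone_set K (pt F x y z) <->
      (l * (x - p) + m * (y - q) + n * (z - r)) ^+ 2 = cos (cone_angle K) ^+ 2 *
      ((x - p) ^+ 2 + (y - q) ^+ 2 + (z - r) ^+ 2)].
Proof.
have [p [q [r VE]]] := pt_surj F (cone_vertex K).
have d0 := cone_dir_neq0 K; have ed := enorm_gt0 _ d0.
have := lin3_dot F ((enorm (cone_dir K))^-1 *: cone_dir K).
set l := dot _ (fi F); set m := dot _ (fj F); set n := dot _ (fk F) => dE.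
have {}dE : cone_dir K = enorm (cone_dir K) *: lin3 F l m n.
  by rewrite -dE scalerA divff ?scale1r ?gt_eqF.
have unit : l ^+ 2 + m ^+ 2 + n ^+ 2 = 1.
  have : dot (cone_dir K) (cone_dir K) = enorm (cone_dir K) ^+ 2.
    by rewrite enorm_sqr.
  rewrite {1 2}dE dotZl dotZr dot_lin3 mulrA -expr2 -!expr2 -[RHS]mulr1.
  by move/mulfI => -> //; rewrite expf_neq0 ?gt_eqF.
exists p, q, r, l, m, n; split=> // x y z.
apply: (iff_trans (cone_setE _ _)).
rewrite VE ptB -enorm_sqr dE.
set g := enorm (_ *: _); have gE : g = enorm (cone_dir K) by rewrite /g -dE.
rewrite gE dotZr !dot_lin3 -!expr2 exprMn.
have e2 : enorm (cone_dir K) ^+ 2 != 0 by rewrite expf_neq0 ?gt_eqF.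
rewrite (mulrC (cos _ ^+ 2)) -(mulrA _ (cos _ ^+ 2)).
split=> [/(mulfI e2) <-|<-]; first by ring.
by congr (_ * _); ring.
Qed.


(** The conditions on a vertex [(p, 0, r)]: necessary by [conic_coefs], sufficient by
    [cone_of_vertex]. *)
Definition vertex_eqs {R : realType} (k a e p r : R) : Prop :=
  (1 - k) * r ^+ 2 = k * (a * (1 - e ^+ 2)) ^+ 2 /\
  (1 - k) * p ^+ 2 = (a * e) ^+ 2 * (1 - k * e ^+ 2).

Lemma cos2_itv {R : realType} (al : R) : 0 < al < pi / 2 ->
  0 < cos al ^+ 2 < 1.
Proof.
move=> h; have s0 := sin_gt0_pihalf h; have /andP[a0 a1] := h.
have c0 : 0 < cos al by apply: cos_gt0_pihalf; rewrite a1 andbT; lra.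
rewrite exprn_gt0 //= -subr_gt0 -sin2cos2; exact: exprn_gt0.
Qed.

Lemma vertex_eqs_neq0 {R : realType} (k a e p r : R) :
  0 < k < 1 -> 0 < a -> 0 < e < 1 -> vertex_eqs k a e p r -> p != 0 /\ r != 0.
Proof.
move=> /andP[k0 k1] a0 /andP[e0 e1] [hr hp].
have ee : 0 < 1 - e ^+ 2 by nra.
have ke : 0 < 1 - k * e ^+ 2 by nra.
split; apply/eqP => h0.
  have : 0 < (a * e) ^+ 2 * (1 - k * e ^+ 2).
    by rewrite mulr_gt0 ?exprn_gt0 ?mulr_gt0.
  by rewrite -hp h0 expr0n mulr0 ltxx.
have : 0 < k * (a * (1 - e ^+ 2)) ^+ 2.
  by rewrite mulr_gt0 ?exprn_gt0 ?mulr_gt0.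
by rewrite -hr h0 expr0n mulr0 ltxx.
Qed.

Lemma belongs_to_coords {R : realType} (F : frame R) (E : ellipse R) (a e : R)
    (K : cone R) :
  let k := cos (cone_angle K) ^+ 2 in
  adapted F E a e -> belongs_to K E ->
  exists p r, [/\ cone_vertex K = pt F p 0 r, vertex_eqs k a e p r &
    forall x y z, cone_set K (pt F x y z) <-> cone_poly k e p r x y z = 0].
Proof.
move=> k ad bel; have [a0 e01 _ _ _ _ _] := ad.
have k01 : 0 < k < 1 := cos2_itv _ (cone_angle_bounds K).
have [p [q [r [l [m [n [VE unit cE]]]]]]] := cone_ptE F K.
have [|[m0 q0 l2 lnr] veq] := conic_coefs a e k p q r l m n a0 e01 k01 unit.
  move=> x y; apply: (iff_trans (iff_sym (cE x y 0))).
  have := ell_set_ptE _ _ _ _ x y 0 ad.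
  rewrite bel /setI /=; have := ell_plane_ptE _ _ _ _ x y 0 ad.
  by tauto.
exists p, r; split=> //; first by rewrite VE q0.
have [p0 r0] := vertex_eqs_neq0 _ _ _ _ _ k01 a0 e01 veq.
have n2 : n ^+ 2 = 1 - k * e ^+ 2 by rewrite -unit l2 m0; ring.
move=> x y z; apply: (iff_trans (cE x y z)).
rewrite m0 q0 mul0r addr0 subr0; exact: cone_polyE.
Qed.

(** Converse of [belongs_to_coords]. The axis is recovered by choosing the positive root for [l] and
    solving the relation for [l * n * r]; the vertex equations are what makes it a unit vector. *)
Lemma cone_of_vertex {R : realType} (F : frame R) (E : ellipse R)
    (a e al p r : R) :
  let k := cos al ^+ 2 in
  adapted F E a e -> 0 < al < pi / 2 -> vertex_eqs k a e p r ->
  exists K : cone R, [/\ cone_angle K = al, cone_vertex K = pt F p 0 r,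
    belongs_to K E &
    forall x y z, cone_set K (pt F x y z) <-> cone_poly k e p r x y z = 0].
Proof.
move=> k ad alB veq; have [a0 e01 _ _ _ _ _] := ad.
have k01 : 0 < k < 1 := cos2_itv _ alB.
have [p0 r0] := vertex_eqs_neq0 _ _ _ _ _ k01 a0 e01 veq.
have [hr hp] := veq; have /andP[e0 e1] := e01; have /andP[k0 k1] := k01.
have c0 : 0 < cos al.
  by case/andP: alB => al0 al1; apply: cos_gt0_pihalf; rewrite al1 andbT; lra.
pose l := cos al * e; have l0 : 0 < l by rewrite mulr_gt0.
have l2 : l ^+ 2 = k * e ^+ 2 by rewrite exprMn.
pose n := k * (1 - e ^+ 2) * p / (l * r).
have lnr : k * (1 - e ^+ 2) * p = l * n * r.
  by rewrite /n; field; rewrite r0 gt_eqF.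
have n2 : n ^+ 2 = 1 - k * e ^+ 2.
  (* Multiplying by this factor clears denominators and produces [(1 - k) * p ^+ 2] and
     [(1 - k) * r ^+ 2], where the vertex equations apply. *)
  have c : (1 - k) * k * e ^+ 2 * r ^+ 2 != 0.
    by rewrite !mulf_neq0 ?expf_neq0 //; rewrite gt_eqF ?subr_gt0.
  apply: (mulfI c).
  have -> : (1 - k) * k * e ^+ 2 * r ^+ 2 * n ^+ 2 = (1 - k) * (l * n * r) ^+ 2.
    transitivity ((1 - k) * (l ^+ 2 * n ^+ 2 * r ^+ 2)); last by ring.
    by rewrite l2; ring.
  rewrite -lnr.
  transitivity ((k * (1 - e ^+ 2)) ^+ 2 * ((1 - k) * p ^+ 2)); first by ring.
  rewrite hp; transitivity (k * e ^+ 2 * ((1 - k) * r ^+ 2) * (1 - k * e ^+ 2)).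
    by rewrite hr; ring.
  by ring.
have dd : dot (lin3 F l 0 n) (lin3 F l 0 n) = 1.
  by rewrite dot_lin3 -!expr2 l2 n2; ring.
have d0 : lin3 F l 0 n != 0 by rewrite -dot_eq0 dd oner_eq0.
pose K := Cone (pt F p 0 r) d0 alB.
have KE x y z : cone_set K (pt F x y z) <-> cone_poly k e p r x y z = 0.
  rewrite -(cone_polyE _ _ _ _ _ _ _ _ _ r0 l2 n2 lnr).
  apply: (iff_trans (cone_setE _ _)).
  rewrite /= ptB dd !dot_lin3 -!expr2 -/k mulr1 subr0 mulr0 addr0.
  by rewrite (mulrC l) (mulrC n).
exists K; split=> //.
apply/seteqP; split=> X; have [x [y [z ->]]] := pt_surj F X.
  move=> /(ell_set_ptE _ _ _ _ _ _ _ ad) [z0 h]; split.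
    by apply/KE; rewrite z0; apply/(cone_poly_ellipse a).
  exact/(ell_plane_ptE _ _ _ _ _ _ _ ad).
move=> [/KE + /(ell_plane_ptE _ _ _ _ _ _ _ ad) z0]; rewrite z0 => h.
by apply/(ell_set_ptE _ _ _ _ _ _ _ ad); split=> //; apply/(cone_poly_ellipse a e k p r).
Qed.

(** * Counting the cones, and the action of the reflections *)

(** The point set is expressed through the vertex coordinates alone, so that counting cones becomes
    counting solutions of [vertex_eqs]. *)
Definition cone_locus {R : realType} (F : frame R) (k e p r : R) :
    set 'rV[R]_3 :=
  [set X | exists x y z, X = pt F x y z /\ cone_poly k e p r x y z = 0].

Lemma cone_locusE {R : realType} (F : frame R) (k e p r : R)
    (C : set 'rV[R]_3) :
  (forall x y z, C (pt F x y z) <-> cone_poly k e p r x y z = 0) ->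
  C = cone_locus F k e p r.
Proof.
move=> CE; apply/seteqP; split=> X.
  by have [x [y [z ->]]] := pt_surj F X => /CE h; exists x, y, z.
by move=> [x [y [z [-> /CE]]]].
Qed.

Lemma cones_of_bloomE {R : realType} (F : frame R) (E : ellipse R)
    (a e theta : R) (C : set 'rV[R]_3) :
  let k := cos (theta / 2) ^+ 2 in
  adapted F E a e -> 0 < theta < pi ->
  cones_of_bloom E theta C <->
    exists p r, vertex_eqs k a e p r /\ C = cone_locus F k e p r.
Proof.
move=> k ad /andP[t0 t1]; split.
  move=> [K [-> /has_bloomE tK bel]].
  have kE : k = cos (cone_angle K) ^+ 2 by rewrite /k tK; congr (cos _ ^+ 2); field.
  have [p [r [_ veq KE]]] := belongs_to_coords _ _ _ _ _ ad bel.
  by exists p, r; rewrite kE; split=> //; exact: cone_locusE.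
move=> [p [r [veq ->]]].
have alB : 0 < theta / 2 < pi / 2 by apply/andP; split; lra.
have [K [aE _ bel KE]] := cone_of_vertex _ _ _ _ _ _ _ ad alB veq.
exists K; split=> //; first by rewrite (cone_locusE _ _ _ _ _ _ KE).
by apply/has_bloomE; rewrite aE; field.
Qed.

(** Both loci are realised by genuine cones, and a cone set determines its vertex. *)
Lemma cone_locus_inj {R : realType} (F : frame R) (E : ellipse R)
    (a e al p r p' r' : R) :
  let k := cos al ^+ 2 in
  adapted F E a e -> 0 < al < pi / 2 ->
  vertex_eqs k a e p r -> vertex_eqs k a e p' r' ->
  cone_locus F k e p r = cone_locus F k e p' r' -> p = p' /\ r = r'.
Proof.
move=> k ad alB veq veq' h.
have [K [_ VE _ KE]] := cone_of_vertex _ _ _ _ _ _ _ ad alB veq.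
have [K' [_ VE' _ KE']] := cone_of_vertex _ _ _ _ _ _ _ ad alB veq'.
have : cone_set K = cone_set K'.
  by rewrite (cone_locusE _ _ _ _ _ _ KE) h -(cone_locusE _ _ _ _ _ _ KE').
by move=> /cone_vertex_eq; rewrite VE VE' => /pt_inj[].
Qed.

Lemma cone_poly_oppx {R : realType} (k e p r x y z : R) :
  cone_poly k e (- p) r x y z = cone_poly k e p r (- x) y z.
Proof. by rewrite /cone_poly; ring. Qed.

(** The sign comes from the extra factor [r] in [cone_poly] and does not affect the zero locus. *)
Lemma cone_poly_oppz {R : realType} (k e p r x y z : R) :
  cone_poly k e p (- r) x y z = - cone_poly k e p r x y (- z).
Proof. by rewrite /cone_poly; ring. Qed.

Lemma reflection_locus_i {R : realType} (F : frame R) (Pi : plane R)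
    (s k e p r : R) :
  plane_normal Pi = lin3 F s 0 0 -> plane_set Pi (fO F) ->
  reflection Pi @` cone_locus F k e p r = cone_locus F k e (- p) r.
Proof.
move=> nE hO; apply/seteqP; split=> X.
  move=> [_ [x [y [z [-> h]]]] <-]; exists (- x), y, z.
  by rewrite (reflection_i _ _ _ _ _ _ nE hO) cone_poly_oppx opprK.
move=> [x [y [z [-> h]]]]; exists (pt F (- x) y z).
  by exists (- x), y, z; rewrite -cone_poly_oppx.
by rewrite (reflection_i _ _ _ _ _ _ nE hO) opprK.
Qed.

Lemma reflection_locus_k {R : realType} (F : frame R) (Pi : plane R)
    (s k e p r : R) :
  plane_normal Pi = lin3 F 0 0 s -> plane_set Pi (fO F) ->
  reflection Pi @` cone_locus F k e p r = cone_locus F k e p (- r).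
Proof.
move=> nE hO; apply/seteqP; split=> X.
  move=> [_ [x [y [z [-> h]]]] <-]; exists x, y, (- z).
  by rewrite (reflection_k _ _ _ _ _ _ nE hO) cone_poly_oppz opprK h oppr0.
move=> [x [y [z [-> h]]]]; exists (pt F x y (- z)).
  exists x, y, (- z); split=> //; apply/eqP.
  by rewrite -oppr_eq0 -cone_poly_oppz h.
by rewrite (reflection_k _ _ _ _ _ _ nE hO) opprK.
Qed.

Lemma vertex_eqs_sqr {R : realType} (k a e p r p' r' : R) :
  0 < k < 1 -> vertex_eqs k a e p r ->
  vertex_eqs k a e p' r' <-> p' ^+ 2 = p ^+ 2 /\ r' ^+ 2 = r ^+ 2.
Proof.
move=> /andP[k0 k1] [hr hp]; rewrite /vertex_eqs -hr -hp.
have kk : 1 - k != 0 by rewrite subr_eq0 (gt_eqF k1).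
by split=> [[/(mulfI kk) -> /(mulfI kk)]|[-> ->]].
Qed.

Lemma vertex_eqs_ex {R : realType} (k a e : R) :
  0 < k < 1 -> 0 < e < 1 -> exists p r, vertex_eqs k a e p r.
Proof.
move=> /andP[k0 k1] /andP[e0 e1].
have kk : 0 < 1 - k by rewrite subr_gt0.
exists (Num.sqrt ((a * e) ^+ 2 * (1 - k * e ^+ 2) / (1 - k))).
exists (Num.sqrt (k * (a * (1 - e ^+ 2)) ^+ 2 / (1 - k))).
rewrite /vertex_eqs !sqr_sqrtr; first by split; field; rewrite gt_eqF.
  by rewrite divr_ge0 ?(ltW kk) // mulr_ge0 ?sqr_ge0 //; nra.
by rewrite divr_ge0 ?(ltW kk) // mulr_ge0 ?sqr_ge0 // ltW.
Qed.


(** The vertex equations fix only [p ^+ 2] and [r ^+ 2], both nonzero, so the solutions are the four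
    sign changes of one of them, and distinct vertices give distinct cones. *)
Lemma card_cones_of_bloom {R : realType} (F : frame R) (E : ellipse R)
    (a e theta : R) :
  adapted F E a e -> 0 < theta < pi -> (cones_of_bloom E theta #= `I_4)%card.
Proof.
move=> ad tB; have [a0 e01 _ _ _ _ _] := ad.
have alB : 0 < theta / 2 < pi / 2.
  by case/andP: tB => t0 t1; apply/andP; split; lra.
set k := cos (theta / 2) ^+ 2.
have k01 : 0 < k < 1 := cos2_itv _ alB.
have [p [r veq]] := vertex_eqs_ex k a e k01 e01.
have [p0 r0] := vertex_eqs_neq0 _ _ _ _ _ k01 a0 e01 veq.
pose sg (b : bool) (t : R) := (-1) ^+ b * t.
have sg2 b t : sg b t ^+ 2 = t ^+ 2 by rewrite exprMn sqrr_sign mul1r.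
have sg_inj b b' t : t != 0 -> sg b t = sg b' t -> b = b'.
  by move=> t0 /(mulIf t0)/eqP; rewrite (inj_eq (@signr_inj _)) => /eqP.
have sgP t t' : t' ^+ 2 = t ^+ 2 -> exists b, t' = sg b t.
  move=> /eqP; rewrite eqf_sqr => /orP[]/eqP ->.
    by exists false; rewrite /sg mul1r.
  by exists true; rewrite /sg mulN1r.
have veqs b b' : vertex_eqs k a e (sg b p) (sg b' r).
  by apply/(vertex_eqs_sqr _ _ _ _ _ _ _ k01 veq); rewrite !sg2.
(* The two binary digits of [n < 4] encode the signs: the low one that of [p], the high one that of
   [r]. *)
pose f n := cone_locus F k e (sg (odd n) p) (sg (1 < n)%N r).
have -> : cones_of_bloom E theta = f @` `I_4.
  apply/seteqP; split=> C.
    move=> /(cones_of_bloomE _ _ _ _ _ _ ad tB) [p' [r' [veq' ->]]].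
    have [/sgP[b ->] /sgP[b' ->]] :=
      iffLR (vertex_eqs_sqr _ _ _ _ _ _ _ k01 veq) veq'.
    exists (b + b'.*2)%N; first by case: b b' => -[].
    by case: b b' => -[].
  move=> [n _ <-]; apply/(cones_of_bloomE _ _ _ _ _ _ ad tB).
  by exists (sg (odd n) p), (sg (1 < n)%N r).
apply: inj_card_eq => m n; rewrite !inE /= => hm hn.
move=> /(cone_locus_inj _ _ _ _ _ _ _ _ _ ad alB (veqs _ _) (veqs _ _)).
move=> [/(sg_inj _ _ _ p0) + /(sg_inj _ _ _ r0)].
by move: m n hm hn => [|[|[|[|//]]]] [|[|[|[|//]]]].
Qed.

Lemma cones_of_bloom_reflection {R : realType} (F : frame R) (E : ellipse R)
    (Pi : plane R) (a e theta s : R) (C C' : set 'rV[R]_3) :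
  adapted F E a e -> 0 < theta < pi ->
  plane_normal Pi = lin3 F s 0 0 -> plane_set Pi (fO F) ->
  cones_of_bloom E theta C -> cones_of_bloom E theta C' -> C <> C' ->
  [\/ C' = reflection (ell_plane E) @` C,
      C' = reflection Pi @` C |
      C' = reflection Pi @` (reflection (ell_plane E) @` C)].
Proof.
move=> ad tB nE hO; have [_ _ _ _ _ hOE [s' [_ nEE]]] := ad.
have k01 : 0 < cos (theta / 2) ^+ 2 < 1.
  by apply: cos2_itv; case/andP: tB => t0 t1; apply/andP; split; lra.
move=> /(cones_of_bloomE _ _ _ _ _ _ ad tB) [p [r [veq ->]]].
move=> /(cones_of_bloomE _ _ _ _ _ _ ad tB) [p' [r' [veq' ->]]].
have [/eqP + /eqP] := iffLR (vertex_eqs_sqr _ _ _ _ _ _ _ k01 veq) veq'.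
rewrite (reflection_locus_k _ _ _ _ _ _ _ nEE hOE).
rewrite !(reflection_locus_i _ _ _ _ _ _ _ nE hO) !eqf_sqr.
(* Equal signs throughout contradict [C <> C']; the three remaining sign patterns are the three
   reflections, in the order of the disjunction. *)
move=> /orP[]/eqP -> /orP[]/eqP -> // _.
- exact: Or31.
- exact: Or32.
- exact: Or33.
Qed.

(** * The hyperbola of vertices *)

(** The focal distances are the absolute values of [p / e - a * e] and [p / e + a * e]. Since
    [p / e] has absolute value at least [a], both numbers have the same sign, and the distances
    differ by [2 * (a * e)]. *)
Lemma vertex_hyperbola {R : realType} (a e k p r : R) :
  0 < a -> 0 < e < 1 -> 0 < k < 1 -> vertex_eqs k a e p r ->
  `|Num.sqrt ((p - a) ^+ 2 + r ^+ 2) - Num.sqrt ((p + a) ^+ 2 + r ^+ 2)|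
  = 2 * (a * e).
Proof.
move=> a0 /andP[e0 e1] /andP[k0 k1] [hr hp].
have ee : 0 < 1 - e ^+ 2 by nra.
have kk : 1 - k != 0 by rewrite subr_eq0 (gt_eqF k1).
have ene : e != 0 by rewrite gt_eqF.
have r2 : e ^+ 2 * r ^+ 2 = (1 - e ^+ 2) * (p ^+ 2 - (a * e) ^+ 2).
  apply: (mulfI kk).
  transitivity (e ^+ 2 * ((1 - k) * r ^+ 2)); first by ring.
  rewrite hr; transitivity ((1 - e ^+ 2) * ((1 - k) * p ^+ 2 - (1 - k) * (a * e) ^+ 2)).
    by rewrite hp; ring.
  by ring.
(* By [r2], this is just the nonnegativity of [e ^+ 2 * r ^+ 2]. *)
have pae : a * e <= `|p|.
  rewrite -(@ler_pXn2r _ 2) ?nnegrE ?mulr_ge0 ?(ltW a0) ?(ltW e0) //.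
  rewrite real_normK ?num_real // -subr_ge0 -(pmulr_rge0 _ ee) -r2.
  by rewrite mulr_ge0 ?sqr_ge0.
have dist (t : R) : t ^+ 2 = a ^+ 2 ->
    Num.sqrt ((p + t) ^+ 2 + r ^+ 2) = `|p / e + t * e|.
  move=> t2; rewrite -sqrtr_sqr; congr (Num.sqrt _).
  apply: (mulfI (expf_neq0 2 ene)); rewrite [LHS]mulrDr r2 exprMn -t2.
  by field.
rewrite dist ?sqrrN // (dist a) //.
have pe : a <= `|p / e| by rewrite normrM normfV (gtr0_norm e0) ler_pdivlMr.
have ae : a * e <= a by rewrite ger_pMr // ltW.
have ae0 : 0 < a * e by rewrite mulr_gt0.
move: pe; set q := p / e; rewrite mulNr.
have [q0|q0] := ger0P q => h.
  rewrite (ger0_norm (_ : 0 <= q + a * e)); last by lra.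
  rewrite (ger0_norm (_ : 0 <= q - a * e)); last by lra.
  by rewrite ler0_norm; lra.
rewrite (ler0_norm (_ : q + a * e <= 0)); last by lra.
rewrite (ler0_norm (_ : q - a * e <= 0)); last by lra.
by rewrite ger0_norm; lra.
Qed.

(** * A frame adapted to the ellipse and to the three planes *)

(** The axes are the focal direction and the unit normals of [Pi'] and of the ellipse plane. The
    focal direction is orthogonal to both normals because each plane contains two points of the
    major axis; the normal of [Pi''] is then orthogonal to the last two axes, hence along the
    first. *)
Lemma adapted_frame {R : realType} (E : ellipse R) (e : R) (A P : 'rV[R]_3)
    (Pi' Pi'' : plane R) :
  ell_ecc E = e -> 0 < e < 1 -> major_axis_endpoints E A P ->
  plane_set Pi' A -> plane_set Pi' P -> perpendicular Pi' (ell_plane E) ->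
  plane_set Pi'' (ell_center E) -> perpendicular Pi'' (ell_plane E) ->
  perpendicular Pi'' Pi' ->
  let a := ell_a E in
  exists F : frame R, [/\ adapted F E a e,
    (A = pt F a 0 0 /\ P = pt F (- a) 0 0) \/
    (A = pt F (- a) 0 0 /\ P = pt F a 0 0),
    plane_set Pi' (fO F) /\ (exists s, plane_normal Pi' = lin3 F 0 s 0) &
    plane_set Pi'' (fO F) /\ (exists s, plane_normal Pi'' = lin3 F s 0 0)].
Proof.
move=> he /andP[e0 e1] hAP hA hP hN'N hO'' hN''N hN''N' a.
set f1 := ell_f1 E in hAP *; set f2 := ell_f2 E.
have a0 : 0 < a.
  have := ell_lt E; have : 0 <= Defs.edist (ell_f1 E) (ell_f2 E) by apply: sqrtr_ge0.
  by rewrite /a; lra.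
have fE : enorm (f2 - f1) = 2 * (a * e).
  have -> : enorm (f2 - f1) = Defs.edist f1 f2.
    by rewrite /Defs.edist /enorm -opprB dotNl dotNr opprK.
  by rewrite -he /ell_ecc -/a -/f1 -/f2; field; rewrite gt_eqF.
have ae0 : 0 < a * e by rewrite mulr_gt0.
have f0 : f2 - f1 != 0.
  by apply: contraTneq ae0 => h; move: fE; rewrite h /enorm dot0l sqrtr0; lra.
pose O := ell_center E; pose u := (enorm (f2 - f1))^-1 *: (f2 - f1).
have uu : dot u u = 1 := enorm_unit _ f0.
have fu : f2 - f1 = (2 * (a * e)) *: u.
  by rewrite -fE [RHS]scalerA divff ?scale1r // fE gt_eqF // mulr_gt0.
have f1E : f1 = O + (- (a * e)) *: u.
  have -> : - (a * e) *: u = (- 2^-1) *: (f2 - f1).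
    by rewrite fu [RHS]scalerA; congr (_ *: _); field.
  by apply/rowP => i; rewrite /O /ell_center -/f1 -/f2 !mxE; field.
have f2E : f2 = O + (a * e) *: u.
  have -> : (a * e) *: u = 2^-1 *: (f2 - f1).
    by rewrite fu [RHS]scalerA; congr (_ *: _); field.
  by apply/rowP => i; rewrite /O /ell_center -/f1 -/f2 !mxE; field.
have {}hO'' : plane_set Pi'' O by [].
clearbody O u.
have f1in := ell_f1_in E; have f2in := ell_f2_in E.
set N := plane_normal (ell_plane E) in f1in f2in.
move: f1in f2in; rewrite /plane_set /= -/N -/f1 -/f2 => f1in f2in.
(* A plane through two points of the focal line contains the line; applied to the ellipse plane with
   the foci, and to [Pi'] with [A] and [P]. *)
have on_line (n q : 'rV[R]_3) s t : s != t -> dot n (O + s *: u - q) = 0 ->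
    dot n (O + t *: u - q) = 0 -> dot n u = 0 /\ dot n (O - q) = 0.
  move=> st; rewrite !dot_lin => h1 h2.
  have nu : dot n u = 0.
    have : (s - t) * dot n u = 0 by lra.
    by move=> /eqP; rewrite mulf_eq0 subr_eq0 (negbTE st) => /eqP.
  by split=> //; move: h1; rewrite nu; lra.
have [Nu NO] : dot N u = 0 /\ dot N (O - plane_pt (ell_plane E)) = 0.
  by apply: (on_line _ _ (- (a * e)) (a * e)); rewrite -?f1E -?f2E //; apply/eqP; lra.
have axis t : t ^+ 2 = a ^+ 2 -> (ell_set E `&` line_through f1 f2) (O + t *: u).
  move=> ta; have ta' : `|t| = a.
    by apply/eqP; rewrite -(@eqrXn2 _ 2) ?(ltW a0) // real_normK ?num_real // ta.
  have d (v w : R) : Defs.edist (O + v *: u) (O + w *: u) = `|v - w|.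
    rewrite /Defs.edist opprD addrACA subrr add0r -scalerBl.
    by rewrite /enorm dotZl dotZr uu mulr1 -expr2 sqrtr_sqr.
  have aea : a * e <= a by rewrite ger_pMr // ltW.
  split.
    split; first by rewrite /plane_set /= -/N addrAC dotDr NO dotZr Nu; lra.
    rewrite -/f1 -/f2 -/a f1E f2E !d opprK.
    move: ta'; have [t0|t0] := ger0P t => ta'.
      by rewrite !ger0_norm; lra.
    by rewrite !ler0_norm; lra.
  exists (2^-1 + t / (2 * (a * e))).
  rewrite fu f1E scalerA -addrA -scalerDl; congr (_ + _ *: _).
  by field; rewrite !gt_eqF.
have u0 : u != 0 by rewrite -dot_eq0 uu oner_eq0.
have na : O + a *: u <> O + (- a) *: u.
  move=> /addrI/eqP; rewrite -subr_eq0 -scalerBl scaler_eq0 (negbTE u0) orbF.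
  by move=> /eqP; lra.
(* The pair [A], [P] is unordered in the hypothesis, so two distinct points of the set identify it
   only up to exchange. *)
have APE : (A = O + a *: u /\ P = O + (- a) *: u) \/
    (A = O + (- a) *: u /\ P = O + a *: u).
  have := axis _ (erefl _); have := axis _ (sqrrN a).
  rewrite hAP => -[] h1 [] h2.
  - by case: na; rewrite h1 h2.
  - by right.
  - by left.
  - by case: na; rewrite h1 h2.
have [N'u N'O] : dot (plane_normal Pi') u = 0 /\
    dot (plane_normal Pi') (O - plane_pt Pi') = 0.
  by case: APE hA hP => -[-> ->] h1 h2; [apply: (on_line _ _ a (- a))|
    apply: (on_line _ _ (- a) a)] => //; apply/eqP; lra.
set N' := plane_normal Pi' in N'u N'O.
pose j := (enorm N')^-1 *: N'; pose n := (enorm N)^-1 *: N.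
have jj : dot j j = 1 := enorm_unit _ (plane_normal_neq0 Pi').
have nn : dot n n = 1 := enorm_unit _ (plane_normal_neq0 (ell_plane E)).
have uj : dot u j = 0 by rewrite dotZr dotC N'u mulr0.
have un : dot u n = 0 by rewrite dotZr dotC Nu mulr0.
have jn : dot j n = 0 by rewrite dotZr dotZl (hN'N : dot N' N = 0) !mulr0.
pose F := Frame R O u j n uu jj nn uj un jn.
have ptu t : O + t *: u = pt F t 0 0 by rewrite /pt /lin3 !scale0r !addr0.
have nor (w : 'rV[R]_3) := lin3_dot F w.
have N'N : dot N' N = 0 := hN'N.
have N''N : dot (plane_normal Pi'') N = 0 := hN''N.
have Nj : dot N j = 0 by rewrite dotZr dotC N'N mulr0.
have N'n : dot N' n = 0 by rewrite dotZr N'N mulr0.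
have N''N' : dot (plane_normal Pi'') N' = 0 := hN''N'.
exists F; split.
- split=> //; rewrite -?/f1 -?/f2 -?ptu ?e0 //.
  exists (dot N n); rewrite -/N; split.
    by rewrite dotZr mulf_neq0 ?invr_eq0 ?gt_eqF ?enorm_gt0 ?dot_gt0 //;
      exact: plane_normal_neq0.
  by rewrite {1}(nor N) /= Nu Nj.
- by rewrite -!ptu.
- split=> //; exists (dot N' j).
  by rewrite -/N' {1}(nor N') /= N'u N'n.
- split=> //; exists (dot (plane_normal Pi'') u).
  by rewrite {1}(nor (plane_normal Pi'')) /= !dotZr N''N N''N' !mulr0.
Qed.

Theorem theorem2p3 (R : realType) (E : ellipse R) (e : R) (A P : 'rV[R]_3)
    (Pi' Pi'' : plane R)
    (he : ell_ecc E = e) (he01 : 0 < e < 1)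
    (hAP : major_axis_endpoints E A P)
    (hPi'A : plane_set Pi' A) (hPi'P : plane_set Pi' P)
    (hPi' : perpendicular Pi' (ell_plane E))
    (hPi''c : plane_set Pi'' (ell_center E))
    (hPi''1 : perpendicular Pi'' (ell_plane E))
    (hPi''2 : perpendicular Pi'' Pi') :
  (forall theta : R, 0 < theta < pi ->
     (cones_of_bloom E theta #= `I_4)%card /\
     (forall C C' : set 'rV[R]_3,
        cones_of_bloom E theta C -> cones_of_bloom E theta C' -> C <> C' ->
        [\/ C' = reflection (ell_plane E) @` C,
            C' = reflection Pi'' @` C |
            C' = reflection Pi'' @` (reflection (ell_plane E) @` C)])) /\
  (exists H : hyperbola R,
     [/\ hyp_plane H = Pi', hyp_f1 H = A, hyp_f2 H = P, hyp_ecc H = e^-1 &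
         forall (theta : R) (K : cone R), 0 < theta < pi ->
           has_bloom K theta -> belongs_to K E -> hyp_set H (cone_vertex K)]).
Proof.
have [F [ad APE [hO' [s' N'E]] [hO'' [s'' N''E]]]] :=
  adapted_frame E e A P Pi' Pi'' he he01 hAP hPi'A hPi'P hPi' hPi''c hPi''1
    hPi''2.
have [a0 _ _ _ _ _ _] := ad; set a := ell_a E in ad APE a0.
have /andP[e0 e1] := he01; have ae0 : 0 < a * e by rewrite mulr_gt0.
split=> [theta tB|].
  split; first exact: card_cones_of_bloom ad tB.
  by move=> C C'; apply: cones_of_bloom_reflection ad tB N''E hO''.
have dAP : Defs.edist A P = 2 * a.
  case: APE => -[-> ->]; rewrite edist_ptE !subrr expr0n !addr0 sqrtr_sqr.
    by rewrite opprK ger0_norm; lra.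
  by rewrite ler0_norm; lra.
have hlt : 2 * (a * e) < Defs.edist A P.
  by rewrite dAP ltr_pM2l // gtr_pMr.
(* Half the distance between the vertices is [a * e] and half the focal distance is [a], whence the
   eccentricity [e^-1]; the vertices of the hyperbola are the foci of the ellipse. *)
exists (Hyperbola hPi'A hPi'P ae0 hlt); split=> //.
  by rewrite /hyp_ecc /= dAP; field; rewrite !gt_eqF.
move=> theta K _ _ bel.
have k01 := cos2_itv _ (cone_angle_bounds K).
have [p [r [VE veq _]]] := belongs_to_coords _ _ _ _ _ ad bel.
have hyp := vertex_hyperbola _ _ _ _ _ a0 he01 k01 veq.
split=> /=.
  rewrite VE /plane_set /= (plane_ptE _ _ _ _ _ _ _ _ N'E hO').
  by rewrite !mul0r mulr0 !addr0.
rewrite VE; case: APE => -[-> ->]; rewrite !edist_ptE subrr expr0n !addr0.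
  by rewrite !subr0 opprK.
by rewrite !subr0 opprK distrC.
Qed.
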